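(* Let $F$ be a finite directed graph, let $\Gamma$ be a finite group, and let $f:\Gamma\to\mathbb{R}$. Define $W_f^\times:\Gamma\times\Gamma\to\mathbb{R}$ by $W_f^\times(x,y)=f(xy)$. Then $$t(\mathrm{Sub}_1^{\to}(F),W_f^\times)\;\geq\; t(\overrightarrow{K_2},W_f^\times)^{e(\mathrm{Sub}_1^{\to}(F))},$$ where $\mathrm{Sub}_1^{\to}(F)$ denotes the directed $1$-subdivision of $F$.
   Context: For a finite directed graph $F=(V,E)$ and $e\in E$, write $e^-$ for the tail and $e^+$ for the head of $e$, and $e(F)=|E|$. The directed $1$-subdivision $\mathrm{Sub}_1^{\to}(F)$ is the directed graph with vertex set $V\sqcup E$ (each edge $e\in E$ is regarded as a new subdivision vertex) and with directed edges $e^-\to e$ and $e\to e^+$ for every $e\in E$; thus every directed edge of $F$ is replaced by a directed path of length two with the same overall direction, and $e(\mathrm{Sub}_1^{\to}(F))=2e(F)$. For a finite set $S$, $\mathbb{E}_{s\in S}$ denotes the uniform average $\frac{1}{|S|}\sum_{s\in S}$. For a kernel $W:\Gamma\times\Gamma\to\mathbb{R}$ on a finite group $\Gamma$ (equipped with the uniform probability measure) and a finite directed graph $H$ with vertex set $V(H)$ and edge set $E(H)$, the directed homomorphism density is $$t(H,W):=\mathbb{E}_{x:V(H)\to\Gamma}\ \prod_{e\in E(H)}W(x_{e^-},x_{e^+}),$$ the average being over all maps $x:V(H)\to\Gamma$. $\overrightarrow{K_2}$ is the directed graph on two vertices consisting of one directed edge, so $t(\overrightarrow{K_2},W)=\mathbb{E}_{x,y\in\Gamma}W(x,y)$.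 Empty products and zeroth powers equal $1$. *)

(* Defs.v *)
From mathcomp Require Import all_boot all_order all_algebra all_fingroup.
From mathcomp Require Import reals.

Set Implicit Arguments.
Unset Strict Implicit.
Unset Printing Implicit Defensive.

Import Order.TTheory GRing.Theory Num.Theory.
Local Open Scope ring_scope.

(* The edge set is an abstract finite type with tail and head maps: loops and
   parallel edges are allowed, and a digraph whose edges are ordered pairs is
   the instance where [edge_tail] and [edge_head] are the two projections. *)
Record digraph := Digraph {
  vertex : finType;
  edge : finType;
  edge_tail : edge -> vertex;
  edge_head : edge -> vertex
}.

Definition num_edges (H : digraph) : nat := #|edge H|.

(* [inl e] is the edge e^- -> e and [inr e] is the edge e -> e^+. *)
Definition sub1_tail (F : digraph) (a : edge F + edge F) : vertex F + edge F :=
  match a with inl e => inl (edge_tail e) | inr e => inr e end.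

Definition sub1_head (F : digraph) (a : edge F + edge F) : vertex F + edge F :=
  match a with inl e => inr e | inr e => inl (edge_head e) end.

Definition sub1 (F : digraph) : digraph :=
  {| vertex := (vertex F + edge F)%type;
     edge := (edge F + edge F)%type;
     edge_tail := @sub1_tail F;
     edge_head := @sub1_head F |}.

Definition K2 : digraph :=
  {| vertex := bool;
     edge := unit;
     edge_tail := fun=> false;
     edge_head := fun=> true |}.

Definition average (R : realType) (S : finType) (g : S -> R) : R :=
  (\sum_(s : S) g s) / #|S|%:R.

Definition hom_density (R : realType) (T : finType) (H : digraph)
    (W : T -> T -> R) : R :=
  average (fun x : {ffun vertex H -> T} =>
    \prod_(e : edge H) W (x (edge_tail e)) (x (edge_head e))).

Definition mul_kernel (R : realType) (gT : finGroupType) (f : gT -> R)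
    (x y : gT) : R := f (x * y)%g.

Lemma num_edges_sub1 (F : digraph) : num_edges (sub1 F) = (2 * num_edges F)%N.
Proof. by rewrite /num_edges card_sum mul2n addnn. Qed.

Lemma hom_density_K2 (R : realType) (T : finType) (W : T -> T -> R) :
  hom_density K2 W = average (fun p : T * T => W p.1 p.2).
Proof.
rewrite /hom_density /average; congr (_ / _%:R); last first.
  by rewrite card_ffun card_bool card_prod expnS expn1.
rewrite (reindex (fun p : T * T => [ffun b : bool => if b then p.2 else p.1])).
  by apply: eq_bigr => p _; rewrite (big_pred1 tt) => [|[]] //=; rewrite !ffunE.
exists (fun x : {ffun bool -> T} => (x false, x true)) => [[a b]|x] _ /=.
  by rewrite !ffunE.
by apply/ffunP=> -[]; rewrite ffunE.
Qed.

(* Main.v *)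
Require Import Defs.
From mathcomp Require Import all_boot all_order all_algebra all_fingroup.
From mathcomp Require Import reals.

(** Write [V] and [E] for the vertices and edges of [F]. The group [gT ^ V]
    acts on [gT ^ E] by [(y . x)_e = x_(e^-)^-1 * y_e * x_(e^+)]. Give a map on
    the vertices of the subdivision the value [x_v] at each [v] in [V] and the
    value [x_(e^-)^-1 * y_e] at each [e] in [E]: the two edges through [e] then
    contribute [f (y_e)] and [f ((y . x)_e)]. So, with [h y = \prod_e f (y_e)],
    the density of the subdivision is the average over [x] and [y] of
    [h y * h (y . x)].

    Such a correlation along a group action is governed by the orthogonal
    projection [P] onto invariant functions, [P h y] being the average of
    [h (y . x)] over [x]: the correlation is [<h, P h> = |P h|^2], and it is at
    least the square of the mean of [P h], by Cauchy-Schwarz against the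
    constant function 1 ([average_act_ge]). The mean of [P h] is that of [h],
    which factors as the [#|E|]-th power of the mean of [f]; and the mean of
    [f] is the density of [K2]. *)

Set Implicit Arguments.
Unset Strict Implicit.
Unset Printing Implicit Defensive.

Import Order.TTheory GRing.Theory Num.Theory.
Local Open Scope ring_scope.

Lemma eq_average (R : realType) (S : finType) (g1 g2 : S -> R) :
  g1 =1 g2 -> average g1 = average g2.
Proof. by move=> eq_g; rewrite /average; under eq_bigr do rewrite eq_g. Qed.

Lemma average_cst (R : realType) (S : finType) (c : R) :
  (0 < #|S|)%N -> average (fun _ : S => c) = c.
Proof.
move=> S_gt0; rewrite /average sumr_const -[c *+ _]mulr_natr mulfK //.
by rewrite pnatr_eq0 -lt0n.
Qed.

Lemma averageMl (R : realType) (S : finType) (c : R) (g : S -> R) :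
  average (fun s => c * g s) = c * average g.
Proof. by rewrite /average -mulr_sumr mulrA. Qed.

Lemma average_exchange (R : realType) (S T : finType) (g : S -> T -> R) :
  average (fun s => average (g s)) = average (fun t => average (g^~ t)).
Proof. by rewrite /average -!mulr_suml exchange_big /= mulrAC. Qed.

Lemma average_pair (R : realType) (S T : finType) (g : S -> T -> R) :
  average (fun p : S * T => g p.1 p.2) = average (fun s => average (g s)).
Proof.
rewrite /average -mulr_suml pair_bigA card_prod natrM invfM /=.
by rewrite -mulrA [X in _ * X]mulrC.
Qed.

Lemma average_reindex (R : realType) (S T : finType) (phi : T -> S)
    (g : S -> R) :
  bijective phi -> average g = average (fun t => g (phi t)).
Proof.
move=> phi_bij; rewrite /average (bij_eq_card phi_bij).
by congr (_ / _); rewrite (reindex phi) //; apply: onW_bij.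
Qed.

Lemma average_ge0 (R : realType) (S : finType) (g : S -> R) :
  (forall s, 0 <= g s) -> 0 <= average g.
Proof. by move=> g_ge0; rewrite divr_ge0 ?ler0n ?sumr_ge0. Qed.

(** The variance of [g] is nonnegative. *)
Lemma sqr_average_le (R : realType) (S : finType) (g : S -> R) :
  average g ^+ 2 <= average (fun s => g s ^+ 2).
Proof.
have [S0|S_gt0] := posnP #|S|.
  by rewrite /average S0 invr0 !mulr0 expr0n.
set m := average g.
have: 0 <= average (fun s => (g s - m) ^+ 2).
  by apply: average_ge0 => s; apply: sqr_ge0.
suff -> : average (fun s => (g s - m) ^+ 2)
          = average (fun s => g s ^+ 2) - m ^+ 2 by rewrite subr_ge0.
transitivity (average (fun s => g s ^+ 2)
              - average (fun s => (2 * m) * g s) + average (fun _ : S => m ^+ 2)).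
  rewrite /average -mulrBl -mulrDl -sumrB -big_split /=; congr (_ / _).
  by apply: eq_bigr => s _; rewrite sqrrB -mulrA mulr_natl [m * g s]mulrC.
rewrite averageMl average_cst // -/m -addrA; congr (_ + _).
by rewrite -mulrA -expr2 mulr_natl mulr2n opprD addrNK.
Qed.

(** Averaging over the action is an orthogonal projection [P] that preserves
    means, so the correlation of [h] with its translates is [|P h|^2]. *)
Lemma average_act_ge (R : realType) (aT : finGroupType) (T : finType)
    (to : {action aT &-> T}) (h : T -> R) :
  average h ^+ 2 <= average (fun x => average (fun y => h y * h (to y x))).
Proof.
have act_bij x : bijective (to^~ x).
  by exists (to^~ x^-1%g) => y; rewrite (actK, actKV).
have aT_gt0 : (0 < #|aT|)%N by apply/card_gt0P; exists 1%g.
set P := fun y => average (fun x => h (to y x)).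
have mean_P : average P = average h.
  rewrite /P average_exchange -[RHS](average_cst _ aT_gt0).
  by apply: eq_average => x; rewrite -(average_reindex h (act_bij x)).
have P_inv y k : P (to y k) = P y.
  rewrite /P [RHS](average_reindex (phi := mulg k)).
    by apply: eq_average => x; rewrite actM.
  by exists (mulg k^-1%g) => x; rewrite (mulKg, mulKVg).
rewrite average_exchange [leRHS](eq_average (g2 := fun y => h y * P y)); last first.
  by move=> y; rewrite averageMl.
(* Since [P] is invariant, translating [y] by [k] and averaging over [k] turns
   the factor [h] into [P]. *)
suff -> : average (fun y => h y * P y) = average (fun y => P y ^+ 2).
  by rewrite -mean_P sqr_average_le.
rewrite -[LHS](average_cst _ aT_gt0).
transitivity (average (fun k => average (fun y => P y * h (to y k)))).
  apply: eq_average => k; rewrite (average_reindex _ (act_bij k)).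
  by apply: eq_average => y; rewrite P_inv mulrC.
by rewrite average_exchange; apply: eq_average => y; rewrite expr2 -averageMl.
Qed.

Lemma average_prod_ffun (R : realType) (I T : finType) (f : T -> R) :
  average (fun y : {ffun I -> T} => \prod_i f (y i)) = average f ^+ #|I|.
Proof.
rewrite /average -(bigA_distr_bigA (fun (_ : I) t => f t)) prodr_const.
by rewrite card_ffun natrX expr_div_n.
Qed.

(** The dependent form of the function type is the one that carries the
    pointwise group structure. *)
Definition vertex_group (F : digraph) (gT : finGroupType) : finGroupType :=
  {dffun forall _ : vertex F, gT}.

Section EdgeAction.

Variables (F : digraph) (gT : finGroupType).

Definition edge_act (y : {ffun edge F -> gT}) (x : vertex_group F gT) :
    {ffun edge F -> gT} :=
  [ffun e => (x (edge_tail e))^-1 * y e * x (edge_head e)]%g.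

Lemma edge_act1 y : edge_act y 1%g = y.
Proof. by apply/ffunP => e; rewrite !ffunE invg1 mul1g mulg1. Qed.

Lemma edge_actM y x1 x2 :
  edge_act y (x1 * x2)%g = edge_act (edge_act y x1) x2.
Proof. by apply/ffunP => e; rewrite !ffunE invMg !mulgA. Qed.

Definition edge_action := TotalAction edge_act1 edge_actM.

(** The change of variables after which the two halves of a subdivided edge
    [e] carry the products [y e] and [edge_act y x e]. *)
Definition sub1_labelling (p : vertex_group F gT * {ffun edge F -> gT}) :
    {ffun vertex F + edge F -> gT} :=
  [ffun s => match s with
             | inl v => p.1 v
             | inr e => ((p.1 (edge_tail e))^-1 * p.2 e)%g
             end].

Lemma sub1_labelling_bij : bijective sub1_labelling.
Proof.
exists (fun w : {ffun vertex F + edge F -> gT} =>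
  ([ffun v => w (inl v)] : vertex_group F gT,
   [ffun e => w (inl (edge_tail e)) * w (inr e)]%g)) => [[x y]|w].
  by congr (_, _); apply/ffunP => s; rewrite !ffunE //= mulKVg.
by apply/ffunP => -[v|e]; rewrite !ffunE //= mulKg.
Qed.

End EdgeAction.

Lemma hom_density_sub1_mul_kernel (R : realType) (F : digraph)
    (gT : finGroupType) (f : gT -> R) (h := fun y : {ffun edge F -> gT} =>
      \prod_e f (y e)) :
  hom_density (sub1 F) (mul_kernel f) =
  average (fun x => average (fun y => h y * h (edge_action F gT y x))).
Proof.
rewrite /hom_density (average_reindex _ (@sub1_labelling_bij F gT)).
rewrite -average_pair; apply: eq_average => -[x y].
rewrite big_sumType /=; congr (_ * _); apply: eq_bigr => e _;
  by rewrite /mul_kernel !ffunE /= ?mulKVg // mulgA.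
Qed.

Lemma hom_density_K2_mul_kernel (R : realType) (gT : finGroupType)
    (f : gT -> R) :
  hom_density K2 (mul_kernel f) = average f.
Proof.
have gT_gt0 : (0 < #|gT|)%N by apply/card_gt0P; exists 1%g.
rewrite hom_density_K2 average_pair -[RHS](average_cst _ gT_gt0).
apply: eq_average => x; rewrite [RHS](average_reindex (phi := mulg x)) //.
by exists (mulg x^-1%g) => y; rewrite (mulKg, mulKVg).
Qed.

Theorem corollary4p1 (R : realType) (F : digraph) (gT : finGroupType)
    (f : gT -> R) :
  hom_density (sub1 F) (mul_kernel f) >=
  hom_density K2 (mul_kernel f) ^+ num_edges (sub1 F).
Proof.
rewrite num_edges_sub1 mulnC exprM hom_density_K2_mul_kernel.
rewrite hom_density_sub1_mul_kernel -average_prod_ffun.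
exact: average_act_ge.
Qed.
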